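(* Let $\mathcal{U}$ be a connected open subset of $\mathbb{R}^n$ and let $(a_1X,a_2X,\dots,a_pX)$ be a rigid $p$-chambar on $\mathcal{U}$, where $X$ is a real analytic vector field on $\mathcal{U}$ and the $a_i$ are real constants. Then the foliation $\mathcal{F}_X$ associated to $X$ is a foliation by straight lines.
   Context: For a real analytic vector field $X$ on an open set $\mathcal{U}\subset\mathbb{R}^n$, $\exp(tX)$ denotes its local flow. A $p$-chambar on $\mathcal{U}$ is a $p$-tuple of pairwise distinct, not identically zero real analytic vector fields $X_1,\dots,X_p$ on $\mathcal{U}$ satisfying the barycentric property: $\sum_{k=1}^p X_k(\exp(tX_k)(x))=0$ for all $x\in\mathcal{U}$ and all small $t\in\mathbb{R}$; equivalently $\sum_{k=1}^p\exp(tX_k)(x)=p\,x$. A $p$-chambar is rigid if it has the form $(a_1X,\dots,a_pX)$ with $X$ a vector field and the $a_i$ constants (necessarily non-zero). $\mathcal{F}_X$ is the (possibly singular) foliation whose leaves are the integral curves of $X$; it is a foliation by straight lines if each leaf through a point where $X\ne0$ (generic leaf) is contained in an affine line of $\mathbb{R}^n$. *)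

(* Defs.v *)
(* Built on MathComp-Analysis. *)
From HB Require Import structures.
From mathcomp Require Import all_boot all_order all_algebra.
From mathcomp Require Import all_classical all_reals all_analysis.

Set Implicit Arguments.
Unset Strict Implicit.
Unset Printing Implicit Defensive.

Import Order.TTheory GRing.Theory Num.Theory.
Import numFieldNormedType.Exports.

Local Open Scope classical_set_scope.
Local Open Scope ring_scope.

Definition monomial (R : realType) (n d : nat)
    (alpha : {ffun 'I_n -> 'I_d.+1}) (h : 'rV[R]_n) : R :=
  \prod_(i < n) h 0 i ^+ alpha i.

(* Multi-indices of total degree d have all entries at most d, so they are
   enumerated by the finite type {ffun 'I_n -> 'I_d.+1}; c is indexed by
   all multi-indices. *)
Definition hom_part (R : realType) (n : nat) (c : {ffun 'I_n -> nat} -> R)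
    (h : 'rV[R]_n) (d : nat) : R :=
  \sum_(alpha : {ffun 'I_n -> 'I_d.+1} | (\sum_(i < n) alpha i)%N == d)
     c [ffun i => nat_of_ord (alpha i)] * monomial alpha h.

Definition hom_abs_part (R : realType) (n : nat)
    (c : {ffun 'I_n -> nat} -> R) (h : 'rV[R]_n) (d : nat) : R :=
  \sum_(alpha : {ffun 'I_n -> 'I_d.+1} | (\sum_(i < n) alpha i)%N == d)
     `|c [ffun i => nat_of_ord (alpha i)] * monomial alpha h|.

(* The terms of the multiple power series are grouped by total degree; since
   the series is required to converge absolutely, the grouping is immaterial. *)
Definition real_analytic_at (R : realType) (n : nat)
    (f : 'rV[R]_n -> R) (x : 'rV[R]_n) : Prop :=
  exists c : {ffun 'I_n -> nat} -> R,
    \forall y \near x,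
      cvgn (series (hom_abs_part c (y - x))) /\
      series (hom_part c (y - x)) @ \oo --> f y.

(* Vector fields on U are total functions of which only the values on U
   matter. *)
Definition analytic_vector_field (R : realType) (n : nat)
    (U : set 'rV[R]_n) (X : 'rV[R]_n -> 'rV[R]_n) : Prop :=
  forall x, U x -> forall j : 'I_n, real_analytic_at (fun y => X y 0 j) x.

Definition integral_curve (R : realType) (n : nat) (U : set 'rV[R]_n)
    (X : 'rV[R]_n -> 'rV[R]_n) (I : set R) (gamma : R -> 'rV[R]_n) : Prop :=
  forall t, I t -> U (gamma t) /\ is_derive t 1 gamma (X (gamma t)).

(* gamma t = exp(tX)(x) for |t| < eps; by uniqueness of solutions of analytic
   differential equations, this determines gamma on the interval. *)
Definition is_local_flow (R : realType) (n : nat) (U : set 'rV[R]_n)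
    (X : 'rV[R]_n -> 'rV[R]_n) (x : 'rV[R]_n) (eps : R)
    (gamma : R -> 'rV[R]_n) : Prop :=
  gamma 0 = x /\ integral_curve U X `]- eps, eps[ gamma.

Definition barycentric (R : realType) (n p : nat) (U : set 'rV[R]_n)
    (X : 'I_p -> 'rV[R]_n -> 'rV[R]_n) : Prop :=
  forall x, U x ->
    exists eps : R, 0 < eps /\
    exists gamma : 'I_p -> R -> 'rV[R]_n,
      (forall k, is_local_flow U (X k) x eps (gamma k)) /\
      (forall t, t \in `]- eps, eps[ -> \sum_(k < p) X k (gamma k t) = 0).

(* A tuple X_1, ..., X_p is nonempty: for p = 0 every condition below but the
   first is void. *)
Record chambar (R : realType) (n p : nat) (U : set 'rV[R]_n)
    (X : 'I_p -> 'rV[R]_n -> 'rV[R]_n) : Prop := Chambar {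
  chambar_pos : (0 < p)%N ;
  chambar_analytic : forall k, analytic_vector_field U (X k) ;
  chambar_neq0 : forall k, exists2 x, U x & X k x != 0 ;
  chambar_distinct :
    forall j k, j != k -> exists2 x, U x & X j x != X k x ;
  chambar_barycentric : barycentric U X
}.

(* The leaf through x of the foliation F_X on U: the union of all integral
   curves of X in U, on any open interval, that pass through x. *)
Definition leaf (R : realType) (n : nat) (U : set 'rV[R]_n)
    (X : 'rV[R]_n -> 'rV[R]_n) (x : 'rV[R]_n) : set 'rV[R]_n :=
  [set y | exists (I : set R) (gamma : R -> 'rV[R]_n) (s t : R),
     [/\ open I /\ is_interval I, integral_curve U X I gamma,
         I s /\ I t, gamma s = x & gamma t = y]].

Definition affine_line (R : realType) (n : nat) (q v : 'rV[R]_n) :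
    set 'rV[R]_n :=
  [set q + s *: v | s in [set: R]].

Definition foliation_by_straight_lines (R : realType) (n : nat)
    (U : set 'rV[R]_n) (X : 'rV[R]_n -> 'rV[R]_n) : Prop :=
  forall x, U x -> X x != 0 ->
    exists q v : 'rV[R]_n, v != 0 /\ leaf U X x `<=` affine_line q v.

(* Main.v *)
(* Differentiating the barycentric identity sum_k a_k X(gamma_k t) = 0 at t = 0,
   where gamma_k' = a_k X(gamma_k) and gamma_k 0 = x, gives
   (sum_k a_k ^ 2) DX(x)(X x) = 0.  The a_k are real and nonzero, hence
   DX(x)(X x) = 0 at every point x of U, which says that X is constant along
   its integral curves. *)
Require Import Defs.
From HB Require Import structures.
From mathcomp Require Import all_boot all_order all_algebra.
From mathcomp Require Import all_classical all_reals all_analysis.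
From mathcomp Require Import ring lra.

Set Implicit Arguments.
Unset Strict Implicit.
Unset Printing Implicit Defensive.

Import Order.TTheory GRing.Theory Num.Theory.
Import numFieldNormedType.Exports.

Local Open Scope classical_set_scope.
Local Open Scope ring_scope.

Lemma ler_norm_entry (R : realDomainType) (m n : nat) (A : 'M[R]_(m, n)) i j :
  `|A i j| <= mx_norm A.
Proof. by rewrite mx_normrE; exact: (le_bigmax _ _ (i, j)). Qed.

Lemma norm_monomial_le (R : realType) (n d : nat)
    (alpha : {ffun 'I_n -> 'I_d.+1}) (h : 'rV[R]_n) (s r : R) :
  (forall i, `|h 0 i| <= s * r) ->
  `|monomial alpha h| <=
    s ^+ (\sum_i alpha i)%N * monomial alpha (const_mx r).
Proof.
move=> hsr; rewrite /monomial normr_prod expr_sum -big_split /=.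
apply: ler_prod => i _; rewrite normr_ge0 normrX mxE -exprMn lerXn2r//.
by rewrite nnegrE (le_trans _ (hsr i)).
Qed.

(** Homogeneity turns absolute convergence at the single point [(r, ..., r)] into a bound at every
    point of the cube of side scale [s * r], with a gain of [s ^+ d] in degree [d]. *)
Lemma norm_hom_part_le (R : realType) (n d : nat)
    (c : {ffun 'I_n -> nat} -> R) (h : 'rV[R]_n) (s r : R) :
  0 <= s -> (forall i, `|h 0 i| <= s * r) ->
  `|hom_part c h d| <= s ^+ d * hom_abs_part c (const_mx r) d.
Proof.
move=> s0 hsr; rewrite mulr_sumr; apply: le_trans (ler_norm_sum _ _ _) _.
apply: ler_sum => alpha /eqP alphad; rewrite !normrM mulrCA ler_wpM2l//.
apply: le_trans (norm_monomial_le alpha hsr) _.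
by rewrite alphad ler_wpM2l ?exprn_ge0// ler_norm.
Qed.

Lemma hom_abs_part_ge0 (R : realType) (n d : nat)
    (c : {ffun 'I_n -> nat} -> R) (h : 'rV[R]_n) : 0 <= hom_abs_part c h d.
Proof. exact: sumr_ge0. Qed.

Lemma differentiable_hom_part (R : realType) (n d : nat)
    (c : {ffun 'I_n -> nat} -> R) (x y : 'rV[R]_n) :
  differentiable (fun z => hom_part c (z - x) d) y.
Proof.
rewrite /hom_part -fct_sumE.
apply: (big_ind (fun g : _ -> R => differentiable g y)) => [||alpha _].
- exact: differentiable_cst.
- by move=> g1 g2; exact: differentiableD.
apply: (@differentiableM _ _ (cst _) (fun z => monomial alpha (z - x))).
  exact: differentiable_cst.
rewrite /monomial -fct_prodE.
apply: (big_ind (fun g : _ -> R => differentiable g y)) => [||i _].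
- exact: differentiable_cst.
- by move=> g1 g2; exact: differentiableM.
case: (nat_of_ord (alpha i)) => [|k]; first exact: differentiable_cst.
rewrite -(exprfctE (fun z : 'rV[R]_n => (z - x) 0 i)); apply: differentiableX.
rewrite (_ : (fun z => _) = (fun z : 'rV[R]_n => z 0 i) - cst (x 0 i));
  last first.
  by apply/funext => z; rewrite !mxE.
apply: differentiableB; first exact: differentiable_coord.
exact: differentiable_cst.
Qed.

(** The bound forces [f x = 0] and makes [f (x + h)] a little-o of [h], so the zero map is the
    differential. *)
Lemma quadratic_differentiable (R : realType) (V W : normedModType R)
    (f : V -> W) (x : V) (C : R) :
  (\forall y \near x, `|f y| <= C * `|y - x| ^+ 2) -> differentiable f x.
Proof.
move=> fC; have fx0 : f x = 0.
  move: (nbhs_singleton fC); rewrite subrr normr0 expr0n mulr0 normr_le0.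
  by move/eqP.
have fo : f \o shift x = cst (f x) + (\0 : {linear V -> W}) +o_ 0 id.
  apply/eqaddoP => e e0 /=.
  have shx : (h + x) @[h --> (0 : V)] --> x.
    rewrite -[X in _ --> X]add0r.
    by apply: cvgD; [exact: cvg_id|exact: cvg_cst].
  have {shx}nC := shx _ fC.
  near=> h.
  rewrite !fctE fx0 /= addr0 subr0.
  have /le_trans : `|f (h + x)| <= C * `|h + x - x| ^+ 2 by near: h.
  apply; rewrite addrK.
  (* [C] may be zero or negative; [|C| + 1] is a positive upper bound for it. *)
  have hd : `|h| <= e / (`|C| + 1).
    rewrite -[h]subr0 -normrN opprB; near: h.
    apply: cvgr_dist_le; first exact: cvg_id.
    by rewrite divr_gt0// ltr_wpDl.
  rewrite expr2 mulrA ler_wpM2r//.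
  apply: le_trans (_ : (`|C| + 1) * `|h| <= _).
    by rewrite ler_wpM2r// (le_trans (ler_norm _))// lerDl.
  by rewrite mulrC -ler_pdivlMr// ltr_wpDl.
apply/diff_locallyP; rewrite (diff_unique _ fo) => [|y]; last exact: cvg_cst.
by split=> // y; exact: cvg_cst.
Unshelve. all: by end_near. Qed.

Lemma real_analytic_at_differentiable (R : realType) (n : nat)
    (f : 'rV[R]_n -> R) (x : 'rV[R]_n) :
  real_analytic_at f x -> differentiable f x.
Proof.
move=> [c fc].
(* The norm is the sup norm, so [x + (r, ..., r)] with [r = e / 2] lies in the ball of radius [e]
   where the expansion converges. *)
have [r r0 cr] : exists2 r : R, 0 < r &
    cvgn (series (hom_abs_part c (const_mx r))).
  have /nbhs_ballP[e /= e0 xe] := fc.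
  exists (e / 2); first exact: divr_gt0.
  have /xe[] : ball x e (x + const_mx (e / 2)); last by rewrite addrC addKr.
  split=> // i j; rewrite mxE mxE /ball /= opprD addNKr.
  by rewrite normrN gtr0_norm ?divr_gt0// ltr_pdivrMr// ltr_pMr// ltr1n.
(* By homogeneity the terms of degree >= 2 at h are at most (|h| / r) ^ 2 times
   those at (r, ..., r), so f differs from P by O(|y - x| ^ 2). *)
set P := fun y => hom_part c (y - x) 0 + hom_part c (y - x) 1.
have dP : differentiable P x.
  by apply: differentiableD; exact: differentiable_hom_part.
rewrite (_ : f = P + (f - P)); last by rewrite addrC subrK.
apply: differentiableD => //.
set M := limn (series (hom_abs_part c (const_mx r))).
apply: (@quadratic_differentiable _ _ _ _ _ (M / r ^+ 2)).
near=> y.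
have [_ fy] : cvgn (series (hom_abs_part c (y - x))) /\
      series (hom_part c (y - x)) @ \oo --> f y by near: y.
have yr : `|y - x| <= r.
  by rewrite distrC; near: y; apply: cvgr_dist_le => //; exact: cvg_id.
set s := `|y - x| / r.
have s0 : 0 <= s by rewrite divr_ge0// ltW.
have s1 : s <= 1 by rewrite ler_pdivrMr// mul1r.
have hs i : `|(y - x) 0 i| <= s * r.
  by rewrite divfK ?gt_eqF//; exact: ler_norm_entry.
rewrite (_ : M / r ^+ 2 * _ = s ^+ 2 * M); last by rewrite /s expr_div_n; ring.
(* The bound is proved for the partial sums and passes to the limit. *)
have : (`|series (hom_part c (y - x)) k - P y|) @[k --> \oo] --> `|f y - P y|.
  by apply: cvg_norm; apply: cvgB => //; exact: cvg_cst.
move/cvgr_to_le; apply.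
near=> k.
have k2 : (2 <= k)%N by near: k; exact: nbhs_infty_ge.
(* For [k >= 2] the partial sum contains both terms of [P y]; they cancel, leaving degrees 2 and
   above. *)
rewrite /series /= (big_cat_nat _ k2)//= big_nat_recr//= big_nat1 -/(P y).
rewrite addrAC subrr add0r; apply: le_trans (ler_norm_sum _ _ _) _.
apply: (@le_trans _ _
    (s ^+ 2 * \sum_(2 <= d < k) hom_abs_part c (const_mx r) d)).
  rewrite mulr_sumr big_nat [leRHS]big_nat; apply: ler_sum => d /andP[d2 _].
  apply: le_trans (norm_hom_part_le d c s0 hs) _.
  by rewrite ler_wpM2r ?hom_abs_part_ge0// ler_wiXn2l.
rewrite ler_wpM2l ?exprn_ge0//.
(* All terms are nonnegative, so the tail is at most the full partial sum, itself at most the limit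
   [M]. *)
apply: le_trans (nondecreasing_cvgn_le _ cr k).
  rewrite /series /= [leRHS](big_cat_nat _ k2)//= lerDr sumr_ge0// => d _.
  exact: hom_abs_part_ge0.
apply/nondecreasing_seqP => m.
by rewrite /series /= big_nat_recr//= lerDl hom_abs_part_ge0.
Unshelve. all: by end_near. Qed.

Lemma is_derive_comp_diff (R : realType) (V W : normedModType R)
    (f : V -> W) (gamma : R -> V) (t : R) (v : V) :
  is_derive t 1 gamma v -> differentiable f (gamma t) ->
  is_derive t 1 (f \o gamma) ('d f (gamma t) v).
Proof.
move=> [/derivable1_diffP dg <-] df.
have dfg : differentiable (f \o gamma) t by exact: differentiable_comp.
apply: DeriveDef; first exact/derivable1_diffP.
by rewrite !deriveE// diff_comp.
Qed.

Lemma is_derive_entry (R : realType) (m n : nat) (gamma : R -> 'M[R]_(m, n))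
    (t : R) (v : 'M[R]_(m, n)) i j :
  is_derive t 1 gamma v -> is_derive t 1 (fun u => gamma u i j) (v i j).
Proof.
move=> [dg <-]; apply: DeriveDef; first by move/derivable_mxP : dg.
by rewrite derive_mx// mxE.
Qed.

(** Mean value theorem on the segment between [s] and [t], which stays in [I]. It serves twice: with
    slope 0 for [X] along a leaf, then with slope [X x 0 j] for the leaf itself. *)
Lemma is_derive_const_affine (R : realType) (I : set R) (f : R -> R) (c : R) :
  is_interval I -> (forall t, I t -> is_derive t 1 f c) ->
  forall s t, I s -> I t -> f t = f s + (t - s) * c.
Proof.
move=> itvI dfc.
have aux s t : s <= t -> I s -> I t -> f t - f s = c * (t - s).
  move=> st Is It.
  have Iu u : u \in `[s, t] -> I u by rewrite in_itv/= => /itvI; exact.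
  have [u /subset_itv_oo_cc/Iu||u _ ->//] := @MVT_segment R f (cst c) s t st.
    exact: dfc.
  by apply: derivable_within_continuous => u /Iu/dfc[].
move=> u v Iu Iv; have [uv|/ltW vu] := leP u v.
  by have := aux _ _ uv Iu Iv; lra.
by have := aux _ _ vu Iv Iu; lra.
Qed.

Lemma barycentric_diff_eq0 (R : realType) (n p : nat) (U : set 'rV[R]_n)
    (X : 'rV[R]_n -> 'rV[R]_n) (a : 'I_p -> R) (x : 'rV[R]_n) (j : 'I_n) :
  (0 < p)%N -> (forall k, a k != 0) -> analytic_vector_field U X ->
  barycentric U (fun k y => a k *: X y) -> U x ->
  'd (fun y => X y 0 j) x (X x) = 0.
Proof.
move=> p0 a0 aX bX Ux; have [e [e0 [gamma [flow sum0]]]] := bX x Ux.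
have dX : differentiable (fun y => X y 0 j) x.
  exact/real_analytic_at_differentiable/aX.
set D := 'd _ x (X x).
(* By the chain rule, one factor [a k] comes from the coefficient, the other from the velocity
   [a k *: X x] of [gamma k] at 0. *)
have dsum : is_derive (0 : R) (1 : R)
    (\sum_(k < p) (a k *: ((fun y => X y 0 j) \o gamma k) : R -> R))
    (\sum_(k < p) a k ^+ 2 * D).
  apply: is_derive_sum => k; have [g0 /(_ 0)[|_ dg]] := flow k.
    by rewrite /= in_itv/= oppr_lt0 e0.
  rewrite g0 in dg.
  rewrite expr2 -mulrA; apply: is_deriveZ.
  rewrite (_ : a k * D = 'd (fun y => X y 0 j) (gamma k 0) (a k *: X x));
    last first.
    by rewrite g0 linearZ.
  by apply: is_derive_comp_diff => //; rewrite g0.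
(* The same sum vanishes on a neighbourhood of 0 by the barycentric property. *)
have dsum0 : is_derive (0 : R) (1 : R)
    (\sum_(k < p) (a k *: ((fun y => X y 0 j) \o gamma k) : R -> R)) 0.
  apply: (@near_eq_is_derive _ _ _ (cst 0)).
  near=> t.
  have /sum0/rowP/(_ j) : t \in `]- e, e[.
    by near: t; apply: near_in_itvoo; rewrite in_itv/= oppr_lt0 e0.
  rewrite summxE mxE fct_sumE /= => sumj; rewrite -[LHS]sumj.
  by apply: eq_bigr => k _; rewrite mxE.
have := @derive_val _ _ _ _ _ _ _ dsum.
rewrite (@derive_val _ _ _ _ _ _ _ dsum0) -mulr_suml => /esym/eqP.
rewrite mulf_eq0 => /orP[|/eqP//].
(* A vanishing sum of real squares would make [a] zero at the index 0, which exists since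
   [0 < p]. *)
rewrite psumr_eq0 => [/allP/(_ (Ordinal p0))|k _]; last exact: sqr_ge0.
by rewrite mem_index_enum /= sqrf_eq0 (negbTE (a0 _)) => /(_ isT).
Unshelve. all: by end_near. Qed.

Theorem theorem4p6 (R : realType) (n p : nat) (U : set 'rV[R]_n)
  (X : 'rV[R]_n -> 'rV[R]_n) (a : 'I_p -> R)
  (openU : open U) (connectedU : connected U)
  (analyticX : analytic_vector_field U X)
  (rigid_chambar : chambar U (fun (k : 'I_p) x => a k *: X x)) :
  foliation_by_straight_lines U X.
Proof.
have [p0 _ aX0 _ bX] := rigid_chambar.
(* A zero coefficient would give an identically zero member of the chambar. *)
have a0 k : a k != 0.
  by have [x _] := aX0 k; apply: contraNneq => ->; rewrite scale0r.
move=> x Ux Xx0; exists x, (X x); split=> //.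
move=> _ [I [gamma [s [t [[_ itvI] intg [Is It] gs <-]]]]].
exists (t - s) => //; apply/rowP => j; rewrite !mxE.
(* The identity [DX(y)(X y) = 0], applied at every point [y] of the curve, says that [X] has zero
   derivative along it. *)
have Xconst u : I u -> X (gamma u) 0 j = X x 0 j.
  move=> Iu; rewrite -gs -[RHS]addr0 -(mulr0 (u - s)).
  apply: (is_derive_const_affine (f := fun v => X (gamma v) 0 j) itvI) => //.
  move=> v Iv.
  have [Ugv dg] := intg v Iv.
  rewrite -(barycentric_diff_eq0 j p0 a0 analyticX bX Ugv).
  apply: is_derive_comp_diff => //.
  exact/real_analytic_at_differentiable/analyticX.
(* The velocity of [gamma] is thus the constant [X x], whence [gamma t = x + (t - s) *: X x]. *)
rewrite -gs; apply/esym.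
apply: (is_derive_const_affine (f := fun v => gamma v 0 j) itvI) => // v Iv.
rewrite gs -(Xconst v Iv); apply: is_derive_entry.
by have [] := intg v Iv.
Qed.
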